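(* Suppose that $X$ is a permutative LD-system. (1) For $x\in X$: $x\in\mathrm{Li}(X)$ if and only if $\mathrm{crit}(x)$ is the greatest element of $\mathrm{crit}[X]$. (2) $x^\sharp(\alpha)\ge\alpha$ for all $x\in X$ and $\alpha\in\mathrm{crit}[X]$. (3) $\mathrm{crit}[X]$ is a linear ordering. (4) For $x\in X$ and $\alpha\in\mathrm{crit}[X]$: $x^\sharp(\alpha)>\alpha$ if and only if $\mathrm{crit}(x)\le\alpha<\max(\mathrm{crit}[X])$. (5) For $x\in X$, $x^\sharp|_A$ is injective where $A=\{\alpha\in\mathrm{crit}[X]\mid x^\sharp(\alpha)<\max(\mathrm{crit}[X])\}$.
   Context: An LD-system is a set $X$ with a binary operation $*$ satisfying $x*(y*z)=(x*y)*(x*z)$. $\mathrm{Li}(X)$ is the set of all $x\in X$ with $x*y=y$ for all $y\in X$. A left-ideal is a subset $I$ with $y\in I\Rightarrow x*y\in I$ for all $x\in X$. The Fibonacci terms are $t_1(x,y)=y$, $t_2(x,y)=x$, $t_{n+2}(x,y)=t_{n+1}(x,y)*t_n(x,y)$. $X$ is permutative if $\mathrm{Li}(X)$ is a left-ideal and for all $x,y\in X$ there is $n\ge1$ with $t_n(x,y)\in\mathrm{Li}(X)$. In a permutative LD-system put $x^0*y=y$, $x^{n+1}*y=x*(x^n*y)$. The statement $\mathrm{crit}(x)\le\mathrm{crit}(y)$ means that $x^n*y\in\mathrm{Li}(X)$ for some $n\ge0$. This relation is reflexive and transitive, and $\mathrm{crit}(x)\le\mathrm{crit}(y)$ implies $\mathrm{crit}(r*x)\le\mathrm{crit}(r*y)$.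 $\mathrm{crit}(x)$ denotes the equivalence class of $x$ under ''$\mathrm{crit}(x)\le\mathrm{crit}(y)$ and $\mathrm{crit}(y)\le\mathrm{crit}(x)$'', and $\mathrm{crit}[X]=\{\mathrm{crit}(x)\mid x\in X\}$ is the resulting partially ordered set. The map $x^\sharp:\mathrm{crit}[X]\to\mathrm{crit}[X]$ is defined by $x^\sharp(\mathrm{crit}(r))=\mathrm{crit}(x*r)$; it is well defined and order preserving. *)

(* Defs.v *)
From HB Require Import structures.
From mathcomp Require Import all_boot all_order generic_quotient.
From mathcomp Require Import boolp classical_sets.

Set Implicit Arguments.
Unset Strict Implicit.
Unset Printing Implicit Defensive.

Local Open Scope quotient_scope.
Local Open Scope classical_set_scope.

Declare Scope ld_scope.
Delimit Scope ld_scope with LD.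

HB.mixin Record isLDSystem (X : Type) := {
  ldop : X -> X -> X;
  ldopD : forall x y z : X, ldop x (ldop y z) = ldop (ldop x y) (ldop x z)
}.

#[short(type="ldType")]
HB.structure Definition LDSystem := {X of isLDSystem X}.

Notation "x * y" := (ldop x y) : ld_scope.
Local Open Scope ld_scope.

Definition Li (X : ldType) : set X := [set x | forall y : X, x * y = y].

Definition left_ideal (X : ldType) (I : set X) : Prop :=
  forall x y : X, I y -> I (x * y).

(* The Fibonacci terms are indexed from 1; the value at 0 is a dummy. *)
Fixpoint fib_term (X : ldType) (x y : X) (n : nat) : X :=
  match n with
  | 0 | 1 => y
  | 2 => x
  | (k.+1 as m).+1 => fib_term x y m * fib_term x y k
  end.

Definition permutative (X : ldType) : Prop :=
  left_ideal (@Li X) /\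
  forall x y : X, exists2 n : nat, (0 < n)%N & Li (fib_term x y n).

HB.mixin Record LDSystem_isPermutative X of LDSystem X := {
  permutativeP : permutative X
}.

#[short(type="permLDType")]
HB.structure Definition PermLDSystem :=
  {X of LDSystem X & LDSystem_isPermutative X}.

(* [iter n (ldop x) y] is $x^n * y$. *)
Definition crit_le (X : ldType) (x y : X) : Prop :=
  exists n : nat, Li (iter n (ldop x) y).

Section CritLe.
Variable X : permLDType.
Implicit Types x y z r : X.

Lemma iter_ldopD n x y z :
  iter n (ldop x) (y * z) = iter n (ldop x) y * iter n (ldop x) z.
Proof. by elim: n => //= n ->; rewrite ldopD. Qed.

Lemma ldop_iter n r x y :
  r * iter n (ldop x) y = iter n (ldop (r * x)) (r * y).
Proof. by elim: n => //= n IHn; rewrite ldopD IHn. Qed.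

Lemma ldop_Li x y : Li y -> Li (x * y).
Proof. by case: (permutativeP (s := X)) => LiX _; apply: LiX. Qed.

Lemma iter_ldop_Li n x y : Li y -> Li (iter n (ldop x) y).
Proof. by move=> Liy; elim: n => //= n; apply: ldop_Li. Qed.

Lemma fib_termS x y n : (0 < n)%N ->
  fib_term x y n.+2 = fib_term x y n.+1 * fib_term x y n.
Proof. by case: n. Qed.

(* In the subalgebra generated by x, left multiplication by any element
   eventually acts on the right powers of x as left multiplication by x. *)
Let absorbs x w := exists N, forall n, (N <= n)%N ->
  w * iter n (ldop x) x = iter n.+1 (ldop x) x.

Let absorbsM x u v : absorbs x u -> absorbs x v -> absorbs x (u * v).
Proof.
move=> [N Nu] [M Mv]; exists (maxn N M).+1 => -[//|n].
rewrite ltnS geq_max => /andP[Nn Mn].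
rewrite -{1}(Nu _ Nn) -ldopD (Mv _ Mn) Nu //; exact: leqW.
Qed.

Lemma crit_le_refl x : crit_le x x.
Proof.
have ax : absorbs x x by exists 0%N.
have afib n : absorbs x (fib_term x x n) /\ absorbs x (fib_term x x n.+1).
  elim: n => [//|[|n] [IHn IHSn]]; split=> //.
  by rewrite fib_termS //; apply: absorbsM.
have apow n : absorbs x (iter n (ldop x) x).
  by elim: n => //= n; apply: absorbsM.
case: (permutativeP (s := X)) => _ perm.
have [k _ Lik] := perm x x.
have [N Nk] := (afib k).1.
have fixN n : (N <= n)%N -> iter n.+1 (ldop x) x = iter n (ldop x) x.
  by move=> Nn; rewrite -(Nk _ Nn) Lik.
set u := iter N (ldop x) x.
have uE n : (N <= n)%N -> iter n (ldop x) x = u.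
  elim: n => [|n IHn]; first by rewrite leqn0 /u => /eqP->.
  rewrite leq_eqVlt => /orP[/eqP<-//|]; rewrite ltnS => Nn.
  by rewrite fixN // IHn.
have uu : u * u = u.
  have [M Mu] := apow N.
  by rewrite -{2}(uE _ (leq_maxl N M)) Mu ?leq_maxr // uE // leqW // leq_maxl.
have fibu n : fib_term u u n = u /\ fib_term u u n.+1 = u.
  elim: n => [//|[|n] [IHn IHSn]]; split=> //.
  by rewrite fib_termS // IHSn IHn.
by have [n _] := perm u u; rewrite (fibu n).1; exists N.
Qed.

Lemma crit_le_trans x y z : crit_le x y -> crit_le y z -> crit_le x z.
Proof.
move=> [n Lin] [m Lim]; exists n.
have := iter_ldop_Li n x Lim.
suff -> : iter n (ldop x) (iter m (ldop y) z) = iter n (ldop x) z by [].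
by elim: m {Lim} => //= m IHm; rewrite iter_ldopD IHm Lin.
Qed.

Lemma crit_le_ldop r x y : crit_le x y -> crit_le (r * x) (r * y).
Proof. by move=> [n Lin]; exists n; rewrite -ldop_iter; apply: ldop_Li. Qed.

(* [{classic X}] is X with the choice structure the quotient requires. *)
Definition crit_equiv : rel {classic X} :=
  fun x y => `[< crit_le (x : X) y /\ crit_le (y : X) x >].

Lemma crit_equiv_refl : reflexive crit_equiv.
Proof. by move=> x; apply/asboolP; split; apply: crit_le_refl. Qed.

Lemma crit_equiv_sym : symmetric crit_equiv.
Proof. by move=> x y; apply/asboolP/asboolP => -[]. Qed.

Lemma crit_equiv_trans : transitive crit_equiv.
Proof.
move=> y x z /asboolP[xy yx] /asboolP[yz zy]; apply/asboolP.
by split; [apply: crit_le_trans xy yz|apply: crit_le_trans zy yx].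
Qed.

Canonical crit_equiv_rel :=
  EquivRel crit_equiv crit_equiv_refl crit_equiv_sym crit_equiv_trans.

Definition crit_set := {eq_quot crit_equiv}.
HB.instance Definition _ := Choice.on crit_set.
HB.instance Definition _ := EqQuotient.on crit_set.

Definition crit (x : X) : crit_set := \pi_crit_set (x : {classic X}).

Lemma crit_eq x y : crit x = crit y <-> crit_le x y /\ crit_le y x.
Proof.
split=> [/eqmodP /asboolP //|xy]; apply/eqmodP; exact/asboolP.
Qed.

Lemma crit_repr (a : crit_set) : crit (repr a) = a.
Proof. exact: reprK. Qed.

Definition crit_set_le (a b : crit_set) : bool :=
  `[< crit_le (repr a : X) (repr b) >].

Lemma crit_set_leE x y : crit_set_le (crit x) (crit y) <-> crit_le x y.
Proof.
have [xx' x'x] := (crit_eq _ _).1 (crit_repr (crit x)).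
have [yy' y'y] := (crit_eq _ _).1 (crit_repr (crit y)).
split=> [/asboolP|] xy.
  exact: crit_le_trans x'x (crit_le_trans xy yy').
apply/asboolP; exact: crit_le_trans xx' (crit_le_trans xy y'y).
Qed.

Lemma crit_set_le_refl : reflexive crit_set_le.
Proof. by move=> a; apply/asboolP; apply: crit_le_refl. Qed.

Lemma crit_set_le_anti : antisymmetric crit_set_le.
Proof.
move=> a b /andP[/asboolP ab /asboolP ba].
by rewrite -(crit_repr a) -(crit_repr b); apply/crit_eq.
Qed.

Lemma crit_set_le_trans : transitive crit_set_le.
Proof.
move=> b a c /asboolP ab /asboolP bc.
by apply/asboolP; apply: crit_le_trans ab bc.
Qed.

Fact crit_display : Order.disp_t. Proof. exact: Order.Disp tt tt. Qed.

HB.instance Definition _ := Order.Le_isPOrder.Build crit_display crit_set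
  crit_set_le_refl crit_set_le_anti crit_set_le_trans.

Lemma le_crit x y : (crit x <= crit y)%O <-> crit_le x y.
Proof. exact: crit_set_leE. Qed.

Definition sharp (x : X) (a : crit_set) : crit_set := crit (x * (repr a : X)).

Lemma sharp_crit x r : sharp x (crit r) = crit (x * r).
Proof.
have [rr' r'r] := (crit_eq _ _).1 (crit_repr (crit r)).
by apply/crit_eq; split; apply: crit_le_ldop.
Qed.

Lemma sharp_homo x (a b : crit_set) : (a <= b)%O -> (sharp x a <= sharp x b)%O.
Proof.
rewrite -(crit_repr a) -(crit_repr b) !sharp_crit => /le_crit ab.
by apply/le_crit; apply: crit_le_ldop.
Qed.

End CritLe.

Arguments crit_set X : clear implicits.

Definition is_greatest d (T : porderType d) (m : T) : Prop :=
  forall a : T, (a <= m)%O.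

(* Main.v *)
Require Import Defs.
From mathcomp Require Import all_boot all_order.
From mathcomp Require Import boolp classical_sets functions.
Local Open Scope classical_set_scope.
Local Open Scope order_scope.

(** Left distributivity turns [x^n * (y * z)] into [(x^n * y) * (x^n * z)], so
that [x^n * (y * z) = x^n * z] as soon as [x^n * y] lies in [Li X].
Linearity is a descent along the Fibonacci terms: comparability of [x * y] with
[x] gives comparability of [x] with [y], and some Fibonacci term lies in
[Li X]. The key point of (4) is that [crit x > crit r] forces [x * r] and [r]
to have the same critical class; (5) follows because if [crit r < crit s], then
[s^n * r] has the class of [r], whereas [(x * s)^n * (x * r) = x * (s^n * r)]. *)

Set Implicit Arguments.
Unset Strict Implicit.
Unset Printing Implicit Defensive.

Import Order.Theory.
Local Open Scope ld_scope.

Lemma iter_ldop_Li_leq (X : permLDType) (x y : X) m n :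
  (m <= n)%N -> Li (iter m (ldop x) y) -> Li (iter n (ldop x) y).
Proof. by move=> /subnK <-; rewrite iterD; apply: iter_ldop_Li. Qed.

Lemma crit_le_Li (X : permLDType) (x y : X) : crit_le x y -> Li x -> Li y.
Proof.
move=> [n Lin] Lix; suff <- : iter n (ldop x) y = y by [].
by elim: n {Lin} => //= n ->; apply: Lix.
Qed.

Lemma Li_crit_le (X : permLDType) (x y : X) : Li y -> crit_le x y.
Proof. by exists 0%N. Qed.

(** Supplies the maximum of [crit_set X] once [X] is inhabited. *)
Lemma Li_exists (X : permLDType) : X -> exists l : X, Li l.
Proof.
move=> x; have [n _ Lin] := (permutativeP (s := X)).2 x x.
by exists (fib_term x x n).
Qed.

Lemma Li_greatest (X : permLDType) (x : X) : Li x <-> is_greatest (crit x).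
Proof.
split=> [Lix a|gx]; first by rewrite -(crit_repr a); apply/le_crit/Li_crit_le.
have [l Lil] := Li_exists x.
exact: crit_le_Li ((le_crit l x).1 (gx (crit l))) Lil.
Qed.

(** By reflexivity some $y^n * y$ lies in [Li X]; then so does $y^n * (x * y) = (y^n * x) * (y^n *
    y)$, a left multiple of it. *)
Lemma crit_le_ldopr (X : permLDType) (x y : X) : crit_le y (x * y).
Proof.
have [n Lin] := crit_le_refl y; exists n.
by rewrite iter_ldopD; apply: ldop_Li.
Qed.

Lemma crit_le_ldop_inv (X : permLDType) (x y : X) :
  crit_le x (x * y) -> crit_le x y.
Proof. by move=> [n Lin]; exists n.+1; rewrite iterSr. Qed.

Lemma crit_le_total (X : permLDType) (x y : X) : crit_le x y \/ crit_le y x.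
Proof.
have descent (u v : X) :
    crit_le (u * v) u \/ crit_le u (u * v) -> crit_le u v \/ crit_le v u.
  case=> [uvu|/crit_le_ldop_inv]; last by left.
  by right; apply: crit_le_trans (crit_le_ldopr u v) uvu.
have fib_descent n : (0 < n)%N ->
    crit_le (fib_term x y n.+1) (fib_term x y n) \/
    crit_le (fib_term x y n) (fib_term x y n.+1) -> crit_le x y \/ crit_le y x.
  (* For index 1 the two terms are [x] and [y] themselves. *)
  elim: n => [//|[//|n] IHn _].
  by rewrite fib_termS // => /descent; apply: IHn.
have [n n_gt0 Lin] := (permutativeP (s := X)).2 x y.
(* The descent starts at a term in [Li X], which lies above everything. *)
by apply: (fib_descent n n_gt0); left; apply: Li_crit_le.
Qed.

Lemma le_sharp (X : permLDType) (x : X) (a : crit_set X) : a <= sharp x a.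
Proof.
by rewrite -(crit_repr a) sharp_crit; apply/le_crit/crit_le_ldopr.
Qed.

Lemma crit_total (X : permLDType) : total (<=%O : rel (crit_set X)).
Proof.
move=> a b; rewrite -(crit_repr a) -(crit_repr b); apply/orP.
by case: (crit_le_total (repr a : X) (repr b)) => ?; [left|right]; apply/le_crit.
Qed.

Lemma crit_iter_ldop (X : permLDType) (x r : X) n :
  crit (x * r) = crit r -> crit (iter n (ldop x) r) = crit r.
Proof. by move=> xr; elim: n => //= n IHn; rewrite -sharp_crit IHn sharp_crit. Qed.

Lemma ldop_fix_Li (X : permLDType) (x r : X) :
  crit_le x r -> crit (x * r) = crit r -> Li r.
Proof.
move=> [n /Li_greatest Lin] /(@crit_iter_ldop _ _ _ n) E.
by apply/Li_greatest; rewrite -E.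
Qed.

Lemma crit_ldop_fix (X : permLDType) (x r : X) :
  ~ crit_le x r -> crit (x * r) = crit r.
Proof.
move=> nxr; apply/crit_eq; split; last exact: crit_le_ldopr.
(* The alternative [crit_le x (x * r)] would give [crit_le x r]. *)
case: (crit_le_total (x * r) x) => [[m Lim]|/crit_le_ldop_inv //].
have [k Lik] := crit_le_refl (x * r).
(* One exponent for both: $(x * r)^n$ sends [x] and [x * r] into [Li X], so $(x * r)^n * (x * r) =
   (x * r)^n * r$. *)
pose n := maxn m k; exists n.
have := iter_ldop_Li_leq (leq_maxr m k) Lik.
by rewrite iter_ldopD (iter_ldop_Li_leq (leq_maxl m k) Lim).
Qed.

Lemma lt_greatest (X : permLDType) (l r : X) :
  Li l -> crit r < crit l <-> ~ Li r.
Proof.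
move=> Lil; have gl := (Li_greatest l).1 Lil; rewrite lt_leAnge gl /=.
split=> [/negP nlr Lir|nLir]; first by apply: nlr; apply: (Li_greatest r).1.
by apply/negP => /le_crit /crit_le_Li /(_ Lil).
Qed.

Lemma lt_sharp (X : permLDType) (x r : X) :
  crit r < sharp x (crit r) <-> crit_le x r /\ ~ Li r.
Proof.
rewrite lt_neqAle le_sharp andbT sharp_crit eq_sym; split=> [/eqP xr|[xr nLir]].
  split=> [|Lir]; first by apply: contra_notP xr; apply: crit_ldop_fix.
  apply: xr; apply/crit_eq.
  by split; apply: Li_crit_le => //; apply: ldop_Li.
by apply/eqP => /(ldop_fix_Li xr).
Qed.

(** Used in both directions, this yields injectivity in (5). If [crit_le s r] fails, $x * (s^n * r)$
    has the class of [x * r], yet lies in [Li X]. *)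
Lemma crit_le_ldop_cancel (X : permLDType) (x r s : X) :
  ~ Li (x * r) -> crit_le (x * s) (x * r) -> crit_le s r.
Proof.
move=> nLi [n]; rewrite -ldop_iter => /Li_greatest.
rewrite -sharp_crit => Lin; apply: contrapT => nsr; apply: nLi.
apply/Li_greatest; rewrite -sharp_crit.
by rewrite -(crit_iter_ldop n (crit_ldop_fix nsr)).
Qed.

Theorem theorem2p21 (X : permLDType) :
  [/\ (forall x : X, Li x <-> is_greatest (crit x)),
      (forall (x : X) (a : crit_set X), a <= sharp x a),
      total (<=%O : rel (crit_set X)),
      (forall x : X, exists2 m : crit_set X, is_greatest m &
         forall a : crit_set X, a < sharp x a <-> crit x <= a /\ a < m)
    & (forall x : X, exists2 m : crit_set X, is_greatest m &
         set_inj [set a : crit_set X | sharp x a < m] (sharp x))].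
Proof.
split=> [x|x a||x|x]; first exact: Li_greatest.
- exact: le_sharp.
- exact: crit_total.
- have [l Lil] := Li_exists x; exists (crit l); first exact/Li_greatest.
  move=> a; rewrite -(crit_repr a); set r : X := repr a.
  split=> [/lt_sharp[xr /(lt_greatest _ Lil)]|[/le_crit xr]].
    by split=> //; apply/le_crit.
  by move=> /(lt_greatest _ Lil) nLir; apply/lt_sharp.
- have [l Lil] := Li_exists x; exists (crit l); first exact/Li_greatest.
  move=> a b; rewrite !inE /= -(crit_repr a) -(crit_repr b) !sharp_crit.
  move=> /(lt_greatest _ Lil) nLia /(lt_greatest _ Lil) nLib /crit_eq[ab ba].
  apply/crit_eq; split; first exact: crit_le_ldop_cancel nLib ab.
  exact: crit_le_ldop_cancel nLia ba.
Qed.
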